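(* Let $a,b:\mathbb{N}\to[0,\infty)$ with $b(0)=0$, and let $\pi$ be a probability measure on $\mathbb{N}$ such that $a(n)\pi(n)=b(n+1)\pi(n+1)$ for all $n\ge 0$. Assume that the Markov chain on $\mathbb{N}$ with generator $$\mathcal{L}f(n)=a(n)\nabla_+f(n)+b(n)\nabla_-f(n)$$ is irreducible. Assume moreover that $a(n)\ge a(n+1)$ and $b(n+1)\ge b(n)$ for all $n\geq 0$, and that there exists $c>0$ such that for every $n\ge 0$ $$a(n)-a(n+1)+b(n+1)-b(n)\ge c .$$ Then for every $f>0$ $$c\,\mathcal{E}(f,\log f)\le \pi\big[\mathcal{L}f\,\mathcal{L}\log f\big]+\pi\Big[\frac{(\mathcal{L}f)^2}{f}\Big],$$ and for every $f>0$ $$c\,\mathrm{Ent}_\pi(f)\le \mathcal{E}(f,\log f).$$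
   Context: $\mathbb{N}=\{0,1,2,\dots\}$. $\nabla_+f(n)=f(n+1)-f(n)$; $\nabla_-f(n)=f(n-1)-f(n)$ for $n\ge1$ and $\nabla_-f(0)=0$. $\pi[g]=\sum_n\pi(n)g(n)$. $\mathcal{E}(f,g)=\pi[a(n)\nabla_+f(n)\nabla_+g(n)]$ is the Dirichlet form, which equals $-\pi[f\mathcal{L}g]$ whenever integrability is not an issue; $\mathcal{E}(f,\log f)\in[0,\infty]$. $\mathrm{Ent}_\pi(f)=\pi[f\log f]-\pi[f]\log\pi[f]$ if $f\log f\in L^1(\pi)$ and $+\infty$ otherwise. ''$f>0$'' means $f:\mathbb{N}\to(0,\infty)$. In the first inequality, $f$ ranges over those $f>0$ for which the right-hand side converges absolutely, i.e. $\pi[(a|\nabla_+f|+b|\nabla_-f|)(a|\nabla_+\log f|+b|\nabla_-\log f|)]<\infty$ and $\pi[(a|\nabla_+f|+b|\nabla_-f|)^2/f]<\infty$. *)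

(* Defs.v *)
From HB Require Import structures.
From mathcomp Require Import all_boot all_order all_algebra.
From mathcomp Require Import all_classical all_reals all_analysis.

Set Implicit Arguments.
Unset Strict Implicit.
Unset Printing Implicit Defensive.

Import Order.TTheory GRing.Theory Num.Theory.
Import numFieldNormedType.Exports.

Local Open Scope classical_set_scope.
Local Open Scope ring_scope.

Definition nabla_plus (R : realType) (f : nat -> R) (n : nat) : R :=
  f n.+1 - f n.

Definition nabla_minus (R : realType) (f : nat -> R) (n : nat) : R :=
  if n is n'.+1 then f n' - f n else 0.

Definition generator (R : realType) (a b : nat -> R) (f : nat -> R) (n : nat)
    : R :=
  a n * nabla_plus f n + b n * nabla_minus f n.

(* For i <> j, the jump rate from i to j is (L 1_{j})(i). *)
Definition jump_rate (R : realType) (L : (nat -> R) -> nat -> R) (i j : nat)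
    : R :=
  L (fun k => (k == j)%:R) i.

Definition irreducible_chain (R : realType) (L : (nat -> R) -> nat -> R)
    : Prop :=
  forall i j : nat, exists p : seq nat,
    path (fun x y => (x != y) && (0 < jump_rate L x y)) i p /\ last i p = j.

Definition mean (R : realType) (pi : probability nat R) (g : nat -> R)
    : \bar R :=
  (\int[pi]_n (g n)%:E)%E.


Definition dirichlet (R : realType) (a : nat -> R) (pi : probability nat R)
    (f g : nat -> R) : \bar R :=
  mean pi (fun n => a n * nabla_plus f n * nabla_plus g n).

(* When f log f is integrable so is f, hence fine is only applied to finite
   means for f > 0. *)
Definition entropy (R : realType) (pi : probability nat R) (f : nat -> R)
    : \bar R :=
  if pi.-integrable setT (fun n => (f n * ln (f n))%R%:E)
  then (mean pi (fun n => f n * ln (f n))%R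
        - (fine (mean pi f) * ln (fine (mean pi f)))%R%:E)%E
  else +oo%E.

Definition abs_generator (R : realType) (a b : nat -> R) (f : nat -> R)
    (n : nat) : R :=
  a n * `|nabla_plus f n| + b n * `|nabla_minus f n|.

(* Main.v *)
Require Import Defs.
From HB Require Import structures.
From mathcomp Require Import all_boot all_order all_algebra.
From mathcomp Require Import all_classical all_reals all_analysis.
From mathcomp Require Import ring lra.

Import Order.TTheory GRing.Theory Num.Theory.
Import numFieldNormedType.Exports.

Local Open Scope classical_set_scope.
Local Open Scope ring_scope.

(** Write [p] for the weights of [pi] and [L] for the generator.

    Convexity. Both means on the right-hand side are sums over vertices of
    [p n * L f n] times [L (ln f) n + L f n / f n]. Expanded over the two edges at
    each vertex and regrouped over edges by detailed balance, the diagonal terms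
    of an edge carry the coefficients [a n - a n.+1] and [b n.+1 - b n], which give
    at least [c * a n * p n] times the energy density, since the contributions of
    both endpoints dominate [(f n.+1 - f n) * (ln (f n.+1) - ln (f n))]. The other
    terms couple two consecutive edges through three values [x, y, z] of [f] and
    are nonnegative by an elementary inequality ([edge_interaction_ge0]). The
    regrouping is done on partial sums ([bochner_partial_sum]), with a boundary
    term that vanishes in the limit under the integrability assumptions
    ([bakry_emery]).

    Entropy inequality. The usual argument integrates the convexity inequality
    along the semigroup. A variational argument on finite chains avoids
    constructing it. Reflect the chain at [N]; for [c' < c], minimize
    [energy - c' * entropy] over the functions with values in a compact interval
    ([ex_box_min]). If [f0] is a minimizer, then [f0 + t * L f0] stays in the
    box for small [t >= 0] ([generator_box]), and the derivative at [t = 0] is at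
    most [(c' - c) * energy f0] by the convexity inequality. Hence [energy f0 = 0],
    [f0] is constant and the minimum is 0 ([finite_mlsi]).

    It remains to let [N] grow. If the energy of [f] is finite, the entropies of
    the truncations are bounded by [energy / c]. Written relative to the average
    they are sums of nonnegative terms, and the term of state 0 alone bounds the
    averages ([averages_bounded]). So [f] and [f * ln f] are integrable and the
    inequality passes to the limit ([mlsi]). *)

(** * Edge inequalities and the Bochner inequality for partial sums *)

Lemma ln_le_sub1 {R : realType} (x : R) : 0 < x -> ln x <= x - 1.
Proof.
move=> x0; rewrite -[in ln x](subrKC 1 x) le_ln1Dx//; lra.
Qed.

Lemma ln_ge_1subV {R : realType} (x : R) : 0 < x -> 1 - x^-1 <= ln x.
Proof.
move=> x0; have := ln_le_sub1 x^-1; rewrite invr_gt0 lnV ?posrE// => /(_ x0).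
lra.
Qed.

Lemma subM_ln_ge0 {R : realType} (x y : R) : 0 < x -> 0 < y ->
  0 <= (y - x) * (ln y - ln x).
Proof.
move=> x0 y0; case: (lerP x y) => xy.
  by rewrite mulr_ge0 ?subr_ge0 ?ler_ln ?posrE.
by rewrite mulr_le0 ?subr_le0 ?ler_ln ?posrE ?ltW.
Qed.

(** The shares of the two endpoints of an edge in [L (ln f) + L f / f]: this
    function equals [a n * birth_term (f n) (f n.+1)] at [n], minus
    [b n * death_term (f n.-1) (f n)]. In terms of [d = ln y - ln x] they are
    [d + e^d - 1] and [d + 1 - e^-d], both increasing in [d]. *)
Definition birth_term {R : realType} (x y : R) := ln y - ln x + y / x - 1.
Definition death_term {R : realType} (x y : R) := ln y - ln x + 1 - x / y.

Lemma birth_term_ge {R : realType} (x y : R) : 0 < x -> 0 < y ->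
  (y - x) * (ln y - ln x) <= (y - x) * birth_term x y.
Proof.
move=> x0 y0; rewrite -subr_ge0.
have -> : (y - x) * birth_term x y - (y - x) * (ln y - ln x) = (y - x) ^+ 2 / x.
  by rewrite /birth_term; field; lra.
by rewrite divr_ge0 ?sqr_ge0 ?ltW.
Qed.

Lemma death_term_ge {R : realType} (x y : R) : 0 < x -> 0 < y ->
  (y - x) * (ln y - ln x) <= (y - x) * death_term x y.
Proof.
move=> x0 y0; rewrite -subr_ge0.
have -> : (y - x) * death_term x y - (y - x) * (ln y - ln x) = (y - x) ^+ 2 / y.
  by rewrite /death_term; field; lra.
by rewrite divr_ge0 ?sqr_ge0 ?ltW.
Qed.

(** The interaction of two consecutive edges. With [s = ln (x * z / y ^+ 2)] the
    left-hand side is [2 * y * (e^s - 1 - s) + (x + z) * (e^-s - 1 + s)], and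
    [1 + s <= e^s] holds for every real [s]. This positivity is what the term
    [(L f)^2 / f] buys, and it is the reason for keeping that term together with
    [L f * L (ln f)]. *)
Lemma edge_interaction_ge0 {R : realType} (x y z : R) : 0 < x -> 0 < y -> 0 < z ->
  0 <= (y - x) * (birth_term x y - birth_term y z)
       + (z - y) * (death_term y z - death_term x y).
Proof.
move=> x0 y0 z0; set s := ln x + ln z - 2 * ln y.
have xzy : 0 < x * z / y ^+ 2 by rewrite divr_gt0 ?mulr_gt0// exprn_gt0.
have sE : s = ln (x * z / y ^+ 2).
  by rewrite ln_div ?posrE ?mulr_gt0 ?exprn_gt0// lnM ?posrE// lnXn// /s mulr_natl.
have ub : s <= x * z / y ^+ 2 - 1 by rewrite sE ln_le_sub1.
have lb : 1 - y ^+ 2 / (x * z) <= s.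
  by rewrite sE (le_trans _ (ln_ge_1subV _ xzy))// invf_div.
have -> : (y - x) * (birth_term x y - birth_term y z)
   + (z - y) * (death_term y z - death_term x y)
   = 2 * y * (x * z / y ^+ 2 - 1 - s) + (x + z) * (s - (1 - y ^+ 2 / (x * z))).
  by rewrite /birth_term /death_term /s; field; rewrite !lt0r_neq0.
by apply: addr_ge0; apply: mulr_ge0; rewrite ?subr_ge0// ltW//; lra.
Qed.

Section Edges.
Context {R : realType} (a b p f : nat -> R) (c : R).
Hypothesis f_gt0 : forall n, 0 < f n.
Hypothesis b0 : b 0%N = 0.
Let g n := ln (f n).
Let A n := birth_term (f n) (f n.+1).
Let B n := death_term (f n) (f n.+1).

(** Its mean is the second derivative of the entropy along the semigroup. *)
Definition entropy_dissipation n :=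
  generator a b f n * generator a b g n + generator a b f n ^+ 2 / f n.

Lemma entropy_dissipation0 :
  entropy_dissipation 0 = a 0%N * nabla_plus f 0 * (a 0%N * A 0).
Proof.
rewrite /entropy_dissipation /generator /nabla_plus b0 /A /birth_term /g.
by field; rewrite lt0r_neq0.
Qed.

Lemma entropy_dissipationS n : entropy_dissipation n.+1 =
  (a n.+1 * nabla_plus f n.+1 - b n.+1 * nabla_plus f n)
  * (a n.+1 * A n.+1 - b n.+1 * B n).
Proof.
rewrite /entropy_dissipation /generator /nabla_plus /nabla_minus /A /B /birth_term.
rewrite /death_term /g.
by field; rewrite lt0r_neq0.
Qed.

(** The part of the square term of edge [n, n.+1] at its upper endpoint that
    remains once [b n.+1 - b n] has gone to the curvature. The previous edge uses
    it against the cross terms at [n], so it enters [edge_bound] with both signs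
    and telescopes. *)
Definition boundary n := a n * p n * nabla_plus f n * (b n * B n).

(** Expanding the dissipation at the vertices gives, for every edge, a square
    term from each endpoint; detailed balance puts the same weight on both. The
    differences of the rates turn part of them into the curvature bound, and the
    rest compensates the cross terms at [n.+1] by [edge_interaction_ge0]. *)
Lemma edge_bound n :
  0 <= p n -> 0 <= p n.+1 ->
  0 <= a n -> 0 <= a n.+1 -> a n.+1 <= a n -> 0 <= b n.+1 -> b n <= b n.+1 ->
  a n * p n = b n.+1 * p n.+1 -> c <= a n - a n.+1 + b n.+1 - b n ->
  c * (a n * p n * nabla_plus f n * nabla_plus g n)
  <= p n * (a n * nabla_plus f n * (a n * A n)) - boundary n
     + p n.+1 * (entropy_dissipation n.+1
                 - a n.+1 * nabla_plus f n.+1 * (a n.+1 * A n.+1))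
     + boundary n.+1.
Proof.
move=> p0 p1 an an1 aa bn1 bb db cu.
have xy := subM_ln_ge0 (f n) (f n.+1) (f_gt0 _) (f_gt0 _).
have xA := birth_term_ge (f n) (f n.+1) (f_gt0 _) (f_gt0 _).
have xB := death_term_ge (f n) (f n.+1) (f_gt0 _) (f_gt0 _).
have tp := edge_interaction_ge0 (f n) (f n.+1) (f n.+2) (f_gt0 _) (f_gt0 _) (f_gt0 _).
rewrite entropy_dissipationS /boundary /A /B /g /nabla_plus.
set A0 := birth_term _ _ in xA tp *; set B0 := death_term _ _ in xB tp *.
set A1 := birth_term (f n.+1) _ in tp *; set B1 := death_term (f n.+1) _ in tp *.
set d := ln _ - ln _ in xy xA xB *.
set Df := f n.+1 - f n in xy xA xB tp *.
set Df1 := f n.+2 - f n.+1 in tp *.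
set r := a n * p n.
have r0 : 0 <= r by rewrite mulr_ge0.
have h1 : 0 <= r * ((a n - a n.+1) * (Df * A0 - Df * d)).
  by rewrite !mulr_ge0// ?subr_ge0.
have h2 : 0 <= r * ((b n.+1 - b n) * (Df * B0 - Df * d)).
  by rewrite !mulr_ge0// ?subr_ge0.
have h3 : 0 <= r * ((a n - a n.+1 + b n.+1 - b n - c) * (Df * d)).
  by apply: mulr_ge0 => //; apply: mulr_ge0 => //; rewrite subr_ge0.
have h4 := mulr_ge0 (mulr_ge0 r0 an1) tp.
have e1 : a n.+1 * p n.+1 * Df1 * (b n.+1 * B1) = r * a n.+1 * (Df1 * B1).
  by rewrite /r db; ring.
have e2 : p n.+1 * ((a n.+1 * Df1 - b n.+1 * Df) * (a n.+1 * A1 - b n.+1 * B0)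
     - a n.+1 * Df1 * (a n.+1 * A1)) =
  r * (Df * (b n.+1 * B0) - Df1 * (a n.+1 * B0) - Df * (a n.+1 * A1)).
  by rewrite /r db; ring.
have e3 : p n * (a n * Df * (a n * A0)) = r * (Df * (a n * A0)) by rewrite /r; ring.
rewrite e1 e2 e3 -subr_ge0.
rewrite [X in 0 <= X](_ : _ = r * ((a n - a n.+1) * (Df * A0 - Df * d)) +
 r * ((b n.+1 - b n) * (Df * B0 - Df * d)) +
 r * ((a n - a n.+1 + b n.+1 - b n - c) * (Df * d)) +
 r * a n.+1 * (Df * (A0 - A1) + Df1 * (B1 - B0))); last ring.
by rewrite !addr_ge0.
Qed.

(** The Bochner inequality for partial sums. It is stated without any summability
    so as to serve both the infinite chain, where the boundary term vanishes in
    the limit, and the finite chains, where it is zero because [a N = 0]; this is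
    also why the rates are constrained only below [N]. *)
Lemma bochner_partial_sum N :
  (forall n, 0 <= p n) -> (forall n, 0 <= a n) -> (forall n, 0 <= b n) ->
  (forall n, (n < N)%N -> [/\ a n.+1 <= a n, b n <= b n.+1,
    a n * p n = b n.+1 * p n.+1 & c <= a n - a n.+1 + b n.+1 - b n]) ->
  c * (\sum_(n < N) a n * p n * nabla_plus f n * nabla_plus g n)
  <= \sum_(n < N.+1) p n * entropy_dissipation n + boundary N.
Proof.
move=> p0 a_ge0 b_ge0 hyp.
(* The induction keeps the square term of the last vertex, which the next
   edge needs. *)
suff: c * (\sum_(n < N) a n * p n * nabla_plus f n * nabla_plus g n)
  <= \sum_(n < N.+1) p n * entropy_dissipation n + boundary N
     - p N * (a N * nabla_plus f N * (a N * A N)).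
  move=> /le_trans; apply; rewrite gerBl mulr_ge0//.
  have := le_trans (subM_ln_ge0 _ _ (f_gt0 N) (f_gt0 N.+1))
                   (birth_term_ge _ _ (f_gt0 N) (f_gt0 N.+1)).
  rewrite -/(A N) -/(nabla_plus f N) => h.
  have -> : a N * nabla_plus f N * (a N * A N) = a N ^+ 2 * (nabla_plus f N * A N).
    by move: (A N) => x; ring.
  by rewrite mulr_ge0 ?sqr_ge0.
elim: N hyp => [|N IH] hyp.
  by rewrite big_ord0 big_ord1 entropy_dissipation0 /boundary b0; lra.
have [] := hyp N (ltnSn N) => aa bb db cu.
have {}IH := IH (fun n nN => hyp n (ltnW nN)).
rewrite big_ord_recr [X in _ <= X + _ - _]big_ord_recr/= mulrDr.
have := edge_bound N (p0 _) (p0 _) (a_ge0 _) (a_ge0 _) aa (b_ge0 _) bb db cu.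
lra.
Qed.

End Edges.

(** * Means as sums of series *)

Section Mean.
Context {R : realType} (pi : probability nat R).
Implicit Type F : nat -> R.

Definition mass n := fine (pi [set n]).

Lemma mass_ge0 n : 0 <= mass n.
Proof. exact: fine_ge0. Qed.

Lemma massE n : pi [set n] = (mass n)%:E.
Proof. by rewrite fineK// fin_num_measure. Qed.

Lemma mean_ge0 F : (forall n, 0 <= F n) -> (0 <= mean pi F)%E.
Proof. by move=> F0; apply: integral_ge0 => n _; rewrite lee_fin. Qed.

Lemma mean_nneseries F : (forall n, 0 <= F n) ->
  mean pi F = (\sum_(0 <= n <oo) (mass n * F n)%:E)%E.
Proof.
move=> F0; rewrite /mean.
have -> : [set: nat] = \bigcup_k [set k].
  by apply/esym/seteqP; split => // n _; exists n.
rewrite ge0_integral_bigcup//=; last 2 first.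
- by move=> n _; rewrite lee_fin.
- by move=> i j _ _ [n []] /= -> ->.
apply: eq_eseriesr => n _.
rewrite (eq_integral (cst (F n)%:E)) => [|x]; last by rewrite inE => ->.
by rewrite integral_cst// EFinM -massE muleC.
Qed.

Lemma partial_sum_le_mean F N : (forall n, 0 <= F n) ->
  ((\sum_(n < N) mass n * F n)%:E <= mean pi F)%E.
Proof.
move=> F0; rewrite mean_nneseries// -sumEFin.
rewrite -(big_mkord xpredT (fun n => (mass n * F n)%:E)).
by apply: nneseries_lim_ge => n _ _; rewrite lee_fin mulr_ge0// mass_ge0.
Qed.

Lemma mean_le_ub F M : (forall n, 0 <= F n) ->
  (forall N, \sum_(n < N) mass n * F n <= M) -> (mean pi F <= M%:E)%E.
Proof.
move=> F0 FM; rewrite mean_nneseries//; apply: lime_le.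
  by apply: is_cvg_nneseries => n _ _; rewrite lee_fin mulr_ge0// mass_ge0.
apply: nearW => N; rewrite sumEFin lee_fin (le_trans _ (FM N))//.
by rewrite big_mkord.
Qed.

Lemma integrable_mean F : (mean pi (fun n => `|F n|%R) < +oo)%E ->
  pi.-integrable setT (EFin \o F).
Proof. by move=> F_lty; apply/integrableP; split. Qed.

Lemma mean_integrable F : pi.-integrable setT (EFin \o F) ->
  (mean pi (fun n => `|F n|%R) < +oo)%E.
Proof. by move=> /integrableP[]. Qed.

Lemma le_mean F G : (forall n, 0 <= F n) -> (forall n, F n <= G n) ->
  (mean pi F <= mean pi G)%E.
Proof.
move=> F0 FG; apply: ge0_le_integral => //= n _; rewrite lee_fin//.
Qed.

Lemma ge0_partial_sum_cvg_mean F : (forall n, 0 <= F n) ->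
  (mean pi F < +oo)%E ->
  (\sum_(n < N) mass n * F n) @[N --> \oo] --> fine (mean pi F).
Proof.
move=> F0 F_lty.
apply: (fine_cvg (f := fun N => (\sum_(n < N) mass n * F n)%:E)).
rewrite fineK ?ge0_fin_numE// ?mean_ge0//.
have Fp n : (0 <= (mass n * F n)%:E)%E by rewrite lee_fin mulr_ge0// mass_ge0.
rewrite mean_nneseries//.
have := @is_cvg_nneseries R (fun n => (mass n * F n)%:E) xpredT 0 (fun n _ _ => Fp n).
by under eq_fun do rewrite sumEFin big_mkord.
Qed.

Lemma partial_sum_cvg_mean F : pi.-integrable setT (EFin \o F) ->
  (\sum_(n < N) mass n * F n) @[N --> \oo] --> fine (mean pi F).
Proof.
move=> iF; have F_lty := mean_integrable _ iF.
pose P n := Num.max (F n) 0; pose M n := Num.max (- F n) 0.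
have P0 n : 0 <= P n by rewrite le_max lexx orbT.
have M0 n : 0 <= M n by rewrite le_max lexx orbT.
have Py : (mean pi P < +oo)%E.
  apply: le_lt_trans F_lty; apply: le_mean => // n.
  by rewrite ge_max ler_norm normr_ge0.
have My : (mean pi M < +oo)%E.
  apply: le_lt_trans F_lty; apply: le_mean => // n.
  by rewrite ge_max -normrN ler_norm normr_ge0.
have mE : mean pi F = (mean pi P - mean pi M)%E.
  rewrite /mean integralE; congr (_ - _)%E; apply: eq_integral => n _.
    by rewrite funeposE /P/= EFin_max.
  by rewrite funenegE /M/= EFin_max.
rewrite mE fineB ?ge0_fin_numE ?mean_ge0//.
have -> : (fun N => \sum_(n < N) mass n * F n) =
    (fun N => \sum_(n < N) mass n * P n) - (fun N => \sum_(n < N) mass n * M n).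
  apply/funext => N; rewrite !fctE -sumrB; apply: eq_bigr => n _.
  rewrite -mulrBr; congr (_ * _).
  by rewrite /P /M; have [?|?] := leP (F n) 0; rewrite ?maxEle; case: ifPn; lra.
by apply: cvgB; apply: ge0_partial_sum_cvg_mean.
Qed.

End Mean.

(** * Convexity of the entropy *)

Lemma abs_generator_ge0 (R : realType) (a b f : nat -> R) n :
  0 <= a n -> 0 <= b n -> 0 <= abs_generator a b f n.
Proof. by move=> a0 b0; rewrite addr_ge0 ?mulr_ge0. Qed.

Lemma le_abs_generator (R : realType) (a b f : nat -> R) n :
  0 <= a n -> 0 <= b n -> `|generator a b f n| <= abs_generator a b f n.
Proof.
move=> a0 b0; rewrite (le_trans (ler_normD _ _))//.
by rewrite !normrM (ger0_norm a0) (ger0_norm b0).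
Qed.

Section BakryEmery.
Context {R : realType} (a b : nat -> R) (pi : probability nat R) (c : R).
Hypotheses (a_ge0 : forall n, 0 <= a n) (b_ge0 : forall n, 0 <= b n).
Hypothesis b0 : b 0%N = 0.
Hypothesis detailed_balance :
  forall n, a n * mass pi n = b n.+1 * mass pi n.+1.
Hypothesis a_noninc : forall n, a n.+1 <= a n.
Hypothesis b_nondec : forall n, b n <= b n.+1.
Hypothesis c_gt0 : 0 < c.
Hypothesis curvature : forall n, c <= a n - a n.+1 + b n.+1 - b n.
Variable f : nat -> R.
Hypothesis f_gt0 : forall n, 0 < f n.
Let g n := ln (f n).

Definition energy_density n := a n * nabla_plus f n * nabla_plus g n.

Lemma energy_density_ge0 n : 0 <= energy_density n.
Proof. by rewrite /energy_density -mulrA mulr_ge0// subM_ln_ge0. Qed.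

Let F1 n := abs_generator a b f n * abs_generator a b g n.
Let F2 n := abs_generator a b f n ^+ 2 / f n.

Let F1_ge0 n : 0 <= F1 n.
Proof. by rewrite mulr_ge0// abs_generator_ge0. Qed.

Let F2_ge0 n : 0 <= F2 n.
Proof. by rewrite divr_ge0 ?sqr_ge0// ltW. Qed.

(** The boundary term only involves the edge [n, n.+1], so it is also controlled at
    the vertex [n.+1], by sequences that the assumptions on [f] make summable. *)
Lemma boundary_le n :
  boundary a b (mass pi) f n <= mass pi n.+1 * F1 n.+1 + mass pi n.+1 * F2 n.+1.
Proof.
rewrite /boundary detailed_balance.
set B := death_term _ _; set p := mass pi n.+1.
have p0 : 0 <= p := mass_ge0 _ _.
set Df := nabla_plus f n; set Dg := g n.+1 - g n.
have BE : B = Dg + Df / f n.+1.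
  by rewrite /B /death_term /Dg /Df /nabla_plus /g; field; rewrite lt0r_neq0.
have bDf : b n.+1 * `|Df| <= abs_generator a b f n.+1.
  rewrite /abs_generator /nabla_minus -normrN opprB -/(nabla_plus f n).
  by rewrite lerDr mulr_ge0.
have bDg : b n.+1 * `|Dg| <= abs_generator a b g n.+1.
  rewrite /abs_generator /nabla_minus -normrN opprB.
  by rewrite lerDr mulr_ge0.
rewrite (le_trans (ler_norm _))// !normrM (ger0_norm (b_ge0 _)) (ger0_norm p0).
rewrite (ger0_norm (b_ge0 _)).
have BB : b n * `|B| <= abs_generator a b g n.+1 + abs_generator a b f n.+1 / f n.+1.
  rewrite (le_trans (ler_wpM2r (normr_ge0 _) (b_nondec n)))//.
  rewrite BE (le_trans (ler_wpM2l (b_ge0 _) (ler_normD _ _)))// mulrDr.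
  rewrite lerD// normrM normfV (gtr0_norm (f_gt0 _)) mulrA.
  by rewrite ler_wpM2r// invr_ge0 ltW.
rewrite -mulrDr (mulrAC _ p) -[leLHS]mulrA mulrCA ler_wpM2l//.
apply: (le_trans (ler_pM _ _ bDf BB)); rewrite ?mulr_ge0//.
by rewrite mulrDr /F1 /F2 expr2 !mulrA.
Qed.

(** The limit of [bochner_partial_sum]; the boundary term is dominated by a
    difference of consecutive partial sums of a convergent series. *)
Lemma bakry_emery :
  (mean pi F1 < +oo)%E -> (mean pi F2 < +oo)%E ->
  (c%:E * mean pi energy_density <=
   mean pi (fun n => generator a b f n * generator a b g n)%R
   + mean pi (fun n => generator a b f n ^+ 2 / f n)%R)%E.
Proof.
move=> F1y F2y.
set G1 := (fun n => _ * _)%R; set G2 := (fun n => _ / f n)%R.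
have G1F1 n : `|G1 n| <= F1 n.
  by rewrite normrM ler_pM ?le_abs_generator.
have G2F2 n : `|G2 n| <= F2 n.
  rewrite normrM normrX normfV (gtr0_norm (f_gt0 _)) ler_wpM2r//.
    by rewrite invr_ge0 ltW.
  by rewrite lerXn2r ?nnegrE ?abs_generator_ge0 ?le_abs_generator.
have iG1 : pi.-integrable setT (EFin \o G1).
  by apply: integrable_mean; apply: le_lt_trans F1y; apply: le_mean.
have iG2 : pi.-integrable setT (EFin \o G2).
  by apply: integrable_mean; apply: le_lt_trans F2y; apply: le_mean.
rewrite -[mean pi G1]fineK ?integrable_fin_num// -[mean pi G2]fineK ?integrable_fin_num//.
rewrite -EFinD -lee_pdivlMl// -EFinM; apply: mean_le_ub => [|N].
  exact: energy_density_ge0.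
rewrite ler_pdivlMl//.
pose S (F : nat -> R) N := \sum_(n < N) mass pi n * F n.
suff [cS H] : (S G1 n.+1 + S G2 n.+1 + (S F1 n.+2 - S F1 n.+1)
    + (S F2 n.+2 - S F2 n.+1)) @[n --> \oo]
    --> fine (mean pi G1) + fine (mean pi G2) /\
  forall n, (N <= n)%N -> c * S energy_density N <= S G1 n.+1 + S G2 n.+1
    + (S F1 n.+2 - S F1 n.+1) + (S F2 n.+2 - S F2 n.+1).
  rewrite -(cvg_lim (@Rhausdorff _) cS); apply: limr_ge; first exact: cvgP cS.
  by exists N => // n /= /H.
split.
  have cvgS F : pi.-integrable setT (EFin \o F) ->
      S F n.+1 @[n --> \oo] --> fine (mean pi F).
    by move=> iF; have := partial_sum_cvg_mean pi F iF; rewrite -(cvg_shiftS (S F)).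
  have cvgB0 F : pi.-integrable setT (EFin \o F) ->
      S F n.+2 - S F n.+1 @[n --> \oo] --> 0.
    move=> iF; rewrite -(subrr (fine (mean pi F))).
    apply: cvgB (cvgS F iF).
    have := cvgS F iF; rewrite -(cvg_shiftS (fun n => S F n.+1)).
    by [].
  have iF1 : pi.-integrable setT (EFin \o F1).
    by apply: integrable_mean; under eq_fun do rewrite ger0_norm//.
  have iF2 : pi.-integrable setT (EFin \o F2).
    by apply: integrable_mean; under eq_fun do rewrite ger0_norm//.
  rewrite -[X in _ --> X]addr0 -[X in _ --> X]addr0.
  by do 3?apply: cvgD; [exact: cvgS|exact: cvgS|exact: cvgB0|exact: cvgB0].
move=> n Nn.
have SD : S energy_density N <= S energy_density n.
  rewrite /S -(subnKC Nn) big_split_ord/= lerDl sumr_ge0// => i _.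
  by rewrite mulr_ge0 ?mass_ge0 ?energy_density_ge0.
rewrite (le_trans (ler_wpM2l (ltW c_gt0) SD))//.
have := bochner_partial_sum a b (mass pi) f c f_gt0 b0 n (mass_ge0 pi) a_ge0 b_ge0.
have -> : \sum_(n0 < n) a n0 * mass pi n0 * nabla_plus f n0 *
     nabla_plus (fun n1 => ln (f n1)) n0 = S energy_density n.
  by apply: eq_bigr => i _; rewrite /energy_density; ring.
have -> : \sum_(n0 < n.+1) mass pi n0 * entropy_dissipation a b f n0
  = S G1 n.+1 + S G2 n.+1.
  by rewrite -big_split; apply: eq_bigr => i _; rewrite /entropy_dissipation mulrDr.
move=> /(_ (fun n _ => And4 (a_noninc n) (b_nondec n) (detailed_balance n)
  (curvature n))) => /le_trans; apply.
have := boundary_le n; rewrite /S !(big_ord_recr n.+1)/=; lra.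
Qed.

End BakryEmery.

(** * Calculus and compactness on finite chains *)

Lemma is_derive_affine {R : realType} (x y : R) :
  is_derive (0 : R) 1 (fun t : R => x + t * y) y.
Proof.
have -> : (fun t : R => x + t * y) = cst x + y *: id.
  by apply/funext => t; rewrite !fctE /= mulrC.
rewrite -[X in is_derive _ _ _ X]add0r -[X in is_derive _ _ _ (_ + X)]mulr1.
exact: is_deriveD.
Qed.

Lemma is_derive_ln_affine {R : realType} (x y : R) : 0 < x ->
  is_derive (0 : R) 1 (fun t : R => ln (x + t * y)) (y / x).
Proof.
move=> x0.
have xE : x + 0 * y = x by rewrite mul0r addr0.
have h : is_derive (x + 0 * y) 1 (@ln R) x^-1.
  by rewrite xE; exact: is_derive1_ln.
have := @is_derive1_comp R (@ln R) (fun t : R => x + t * y) 0 x^-1 y h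
  (is_derive_affine x y).
by rewrite mulrC.
Qed.

Lemma decreasing_near_right {R : realType} (phi : R -> R) (d : R) :
  is_derive (0 : R) 1 phi d -> d < 0 ->
  exists2 e : R, 0 < e & forall t, 0 < t -> t < e -> phi t < phi 0.
Proof.
move=> [phid dE] d0.
have : (fun h => h^-1 *: ((phi \o shift 0) (h *: 1) - phi 0)) @ 0^' --> 'D_1 phi 0.
  exact: phid.
rewrite dE => /cvgr_lt/(_ 0 d0).
move=> /nbhs_ballP[e /= e0 H]; exists e => // t t0 te.
have := H t; rewrite /ball/= sub0r normrN gtr0_norm// => /(_ te).
move=> /(_ (lt0r_neq0 t0)); rewrite addr0 [X in phi X]mulr1.
by rewrite /GRing.scale/= pmulr_rlt0 ?invr_gt0// subr_lt0.
Qed.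

Lemma compact_box_min {R : realType} N (l u : R) (Phi : 'rV[R]_N -> R) :
  l <= u -> continuous Phi ->
  exists2 v : 'rV[R]_N, (forall i, l <= v ord0 i <= u) &
    forall w : 'rV[R]_N, (forall i, l <= w ord0 i <= u) -> Phi v <= Phi w.
Proof.
move=> lu cPhi.
pose A := [set v : 'rV[R]_N | forall i, `[l, u]%classic (v ord0 i)].
have cA : compact A :=
  @rV_compact R N (fun=> `[l, u]%classic) (fun=> @segment_compact R l u).
have A0 : A !=set0.
  by exists (const_mx l) => i; rewrite mxE /= in_itv/= lexx.
have [v vA vmin] := compact_EVT_min A0 cA (continuous_subspaceT cPhi).
exists v => [i|w wb].
  by move: vA; rewrite inE => /(_ i); rewrite /= in_itv.
by apply: vmin; rewrite inE => i; rewrite /= in_itv/= wb.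
Qed.

(** Reversibility on an initial segment; the first term is the flux through the
    last edge. *)
Lemma summation_by_parts {R : realType} (a b p u w : nat -> R) N :
  b 0%N = 0 -> (forall n, (n < N)%N -> a n * p n = b n.+1 * p n.+1) ->
  \sum_(n < N.+1) p n * (u n * generator a b w n) =
  a N * p N * u N * nabla_plus w N
  - \sum_(n < N) a n * p n * nabla_plus u n * nabla_plus w n.
Proof.
move=> b0; elim: N => [|N IH] db.
  by rewrite big_ord1 big_ord0 /generator b0; ring.
rewrite big_ord_recr/= IH => [|n nN]; last by rewrite db// ltnW.
rewrite [in RHS]big_ord_recr/= /generator /nabla_minus.
have -> : p N.+1 * (u N.+1 * (a N.+1 * nabla_plus w N.+1 + b N.+1 * (w N - w N.+1)))
  = a N.+1 * p N.+1 * u N.+1 * nabla_plus w N.+1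
    - (b N.+1 * p N.+1) * u N.+1 * nabla_plus w N by rewrite /nabla_plus; ring.
by rewrite -db// /nabla_plus; ring.
Qed.

Lemma is_deriveM_fun {R : realType} (u w : R -> R) (x du dw : R) :
  is_derive x 1 u du -> is_derive x 1 w dw ->
  is_derive x 1 (fun t => u t * w t) (du * w x + u x * dw).
Proof.
move=> hu hw; apply: (is_derive_eq (is_deriveM hu hw)).
by rewrite addrC mulrC.
Qed.

Lemma is_deriveMl_fun {R : realType} (k : R) (u : R -> R) (x du : R) :
  is_derive x 1 u du -> is_derive x 1 (fun t => k * u t) (k * du).
Proof. by move=> hu; exact: (@is_deriveZ _ _ _ u k). Qed.

Lemma is_deriveB_fun {R : realType} (u w : R -> R) (x du dw : R) :
  is_derive x 1 u du -> is_derive x 1 w dw ->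
  is_derive x 1 (fun t => u t - w t) (du - dw).
Proof. by move=> hu hw; exact: (is_deriveB hu hw). Qed.

Lemma is_derive_sum_fun {R : realType} N (u : nat -> R -> R) (x : R)
    (du : nat -> R) :
  (forall n, is_derive x 1 (u n) (du n)) ->
  is_derive x 1 (fun t => \sum_(n < N) u n t) (\sum_(n < N) du n).
Proof.
move=> hu.
have := @is_derive_sum _ _ _ N (fun n : 'I_N => u n) x 1 (fun n : 'I_N => du n)
  (fun n => hu n).
rewrite (_ : (\sum_(i < N) u i) = (fun t => \sum_(n < N) u n t))//.
by apply/funext => t; rewrite fct_sumE.
Qed.

Lemma continuousM_fun {R : realType} (T : topologicalType) (u w : T -> R) :
  continuous u -> continuous w -> continuous (fun h => u h * w h).
Proof. by move=> cu cw h; exact: (continuousM (cu h) (cw h)). Qed.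

Lemma continuousB_fun {R : realType} (T : topologicalType) (u w : T -> R) :
  continuous u -> continuous w -> continuous (fun h => u h - w h).
Proof. by move=> cu cw h; exact: (continuousB (cu h) (cw h)). Qed.

Lemma continuous_sum_fun {R : realType} (T : topologicalType) (k : nat -> T -> R) M :
  (forall n, continuous (k n)) ->
  continuous (fun v => \sum_(n < M) k n v).
Proof.
move=> ck; elim: M => [|M IH] v.
  rewrite (_ : (fun v => _) = cst 0); first exact: cst_continuous.
  by apply/funext => w; rewrite big_ord0.
rewrite (_ : (fun v => _) = (fun v => \sum_(n < M) k n v) \+ k M).
  exact: (continuousD (IH v) (ck M v)).
by apply/funext => w; rewrite big_ord_recr.
Qed.

Section FiniteChain.
Context {R : realType} (a b p : nat -> R) (N : nat).

Definition energy (f : nat -> R) :=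
  \sum_(n < N) a n * p n * nabla_plus f n * nabla_plus (fun k => ln (f k)) n.

Definition sum_flnf (f : nat -> R) := \sum_(n < N.+1) p n * (f n * ln (f n)).

Definition total (f : nat -> R) := \sum_(n < N.+1) p n * f n.

(** Normalized by the total mass, so that constants have zero entropy although
    the restriction of a probability to an initial segment has mass below 1. *)
Definition finite_entropy f :=
  sum_flnf f - total f * ln (total f / total (fun=> 1)).

Lemma is_derive_energy f v : (forall n, 0 < f n) ->
  is_derive (0 : R) 1 (fun t : R => energy (fun n => f n + t * v n))
    (\sum_(n < N) a n * p n *
       (nabla_plus v n * nabla_plus (fun k => ln (f k)) n
        + nabla_plus f n * nabla_plus (fun k => v k / f k) n)).
Proof.
move=> f0.
pose u n t := a n * p n * ((f n.+1 + t * v n.+1 - (f n + t * v n)) *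
   (ln (f n.+1 + t * v n.+1) - ln (f n + t * v n))).
have -> : (fun t : R => energy (fun n => f n + t * v n)) =
   (fun t => \sum_(n < N) u n t).
  apply/funext => t; apply: eq_bigr => n _.
  by rewrite /u /nabla_plus !mulrA.
have E1 k : f k + 0 * v k = f k by rewrite mul0r addr0.
apply: (@is_derive_sum_fun R N u 0 (fun n => a n * p n *
  (nabla_plus v n * nabla_plus (fun k => ln (f k)) n
   + nabla_plus f n * nabla_plus (fun k => v k / f k) n))) => n.
apply: is_deriveMl_fun.
have := is_deriveM_fun _ _ _ _ _
  (is_deriveB_fun _ _ _ _ _ (is_derive_affine (f n.+1) (v n.+1))
                            (is_derive_affine (f n) (v n)))
  (is_deriveB_fun _ _ _ _ _ (is_derive_ln_affine (f n.+1) (v n.+1) (f0 _))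
                            (is_derive_ln_affine (f n) (v n) (f0 _))).
by rewrite !E1.
Qed.

Lemma is_derive_sum_flnf f v : (forall n, 0 < f n) ->
  is_derive (0 : R) 1 (fun t : R => sum_flnf (fun n => f n + t * v n))
    (total v + \sum_(n < N.+1) p n * (v n * ln (f n))).
Proof.
move=> f0.
have -> : total v + \sum_(n < N.+1) p n * (v n * ln (f n)) =
   \sum_(n < N.+1) p n * (v n * ln (f n) + f n * (v n / f n)).
  rewrite addrC -big_split; apply: eq_bigr => n _ /=.
  by rewrite [f n * _]mulrC divfK ?lt0r_neq0// mulrDr.
have E1 k : f k + 0 * v k = f k by rewrite mul0r addr0.
apply: (@is_derive_sum_fun R N.+1
  (fun n t => p n * ((f n + t * v n) * ln (f n + t * v n))) 0
  (fun n => p n * (v n * ln (f n) + f n * (v n / f n)))) => n.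
apply: is_deriveMl_fun.
have := is_deriveM_fun _ _ _ _ _ (is_derive_affine (f n) (v n))
                                 (is_derive_ln_affine (f n) (v n) (f0 _)).
by rewrite E1.
Qed.

Lemma eq_energy f g : (forall n, (n <= N)%N -> f n = g n) -> energy f = energy g.
Proof.
move=> fg; apply: eq_bigr => n _; rewrite /nabla_plus.
by rewrite !fg// ltnW.
Qed.

Lemma eq_finite_entropy f g : (forall n, (n <= N)%N -> f n = g n) ->
  finite_entropy f = finite_entropy g.
Proof.
move=> fg; rewrite /finite_entropy.
have -> : total f = total g by apply: eq_bigr => n _; rewrite fg// -ltnS.
by congr (_ - _); apply: eq_bigr => n _; rewrite fg// -ltnS.
Qed.

Hypothesis p_gt0 : forall n, (n <= N)%N -> 0 < p n.

Lemma total_gt0 f : (forall n, 0 < f n) -> 0 < total f.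
Proof.
move=> f0; rewrite /total big_ord_recr/= ltr_wpDl//.
  by rewrite sumr_ge0// => i _; rewrite mulr_ge0// ltW// p_gt0// ltnW.
by rewrite mulr_gt0// p_gt0.
Qed.

(** The functional depends continuously on the finitely many logarithms
    [ln (f n)], [n <= N], which range over a compact box. Logarithmic coordinates
    make it continuous on the whole space, so no restriction to positive vectors
    is needed. *)
Lemma ex_box_min c' l u : 0 < l -> l <= u -> exists f0,
  (forall n, l <= f0 n <= u) /\
  (forall f, (forall n, (n <= N)%N -> l <= f n <= u) ->
     energy f0 - c' * finite_entropy f0 <= energy f - c' * finite_entropy f).
Proof.
move=> l0 lu.
(* Values beyond [N] repeat [f 0]: there [inord] returns its default [ord0]. *)
pose e (h : 'rV[R]_N.+1) n := expR (h ord0 (inord n)).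
have e0 h n : 0 < e h n by exact: expR_gt0.
have ce n : continuous (e^~ n).
  by move=> h; apply: continuous_comp; [exact: coord_continuous|exact: continuous_expR].
have cln n : continuous (fun h => ln (e h n)).
  move=> h; rewrite /e; under eq_fun do rewrite expRK.
  exact: coord_continuous.
have ck (k : R) : continuous (fun _ : 'rV[R]_N.+1 => k) by exact: cst_continuous.
have ctot : continuous (fun h => total (e h)).
  apply: (continuous_sum_fun _ (fun n h => p n * e h n)) => n.
  exact: continuousM_fun.
have cen : continuous (fun h => energy (e h)).
  apply: (continuous_sum_fun _ (fun n h => a n * p n * nabla_plus (e h) n *
       nabla_plus (fun k => ln (e h k)) n)) => n.
  apply: continuousM_fun; last exact: continuousB_fun.
  by apply: continuousM_fun => //; exact: continuousB_fun.
have cflnf : continuous (fun h => sum_flnf (e h)).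
  apply: (continuous_sum_fun _ (fun n h => p n * (e h n * ln (e h n)))) => n.
  by apply: continuousM_fun => //; exact: continuousM_fun.
have cent : continuous (fun h => finite_entropy (e h)).
  apply: continuousB_fun => //; apply: continuousM_fun => // h.
  apply: (@continuous_comp _ _ _ (fun h => total (e h) / total (fun=> 1)) (@ln R)).
    exact: continuousM_fun.
  by apply: continuous_ln; rewrite divr_gt0// total_gt0.
have cPhi : continuous (fun h => energy (e h) - c' * finite_entropy (e h)).
  by apply: continuousB_fun => //; exact: continuousM_fun.
have u0 : 0 < u by exact: lt_le_trans lu.
have lnlu : ln l <= ln u by rewrite ler_ln.
have [h hb hmin] := compact_box_min _ _ _ _ lnlu cPhi.
exists (e h); split.
  move=> n; have /andP[] := hb (inord n).
  by rewrite -(ler_expR (ln l)) -(ler_expR _ (ln u)) !lnK ?posrE// /e => -> ->.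
move=> f fb; pose w : 'rV[R]_N.+1 := \row_i ln (f i).
have f0 n : (n <= N)%N -> 0 < f n.
  by move=> /fb/andP[/(lt_le_trans l0)].
have we n : (n <= N)%N -> e w n = f n.
  by move=> nN; rewrite /e mxE inordK// lnK// posrE f0.
have := hmin w; rewrite (eq_energy _ _ we) (eq_finite_entropy _ _ we); apply => i.
have iN : (i <= N)%N by rewrite -ltnS.
by have /andP[? ?] := fb i iN; rewrite mxE !ler_ln ?posrE ?f0//; apply/andP.
Qed.

End FiniteChain.

(** * The entropy inequality on finite chains *)

Lemma subM_ln_eq0 {R : realType} (x y : R) : 0 < x -> 0 < y ->
  (y - x) * (ln y - ln x) = 0 -> x = y.
Proof.
move=> x0 y0 /eqP; rewrite mulf_eq0 !subr_eq0 => /orP[/eqP//|/eqP h].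
by apply/ln_inj; rewrite ?posrE.
Qed.

Lemma finite_entropy_cst {R : realType} (p : nat -> R) N x :
  total p N (fun=> 1) != 0 -> finite_entropy p N (fun=> x) = 0.
Proof.
move=> Z0; have tx : total p N (fun=> x) = total p N (fun=> 1) * x.
  by rewrite /total mulr_suml; apply: eq_bigr => n _; rewrite mulr1.
rewrite /finite_entropy tx [_ * x / _]mulrAC divff// mul1r /sum_flnf -mulr_suml.
rewrite (_ : \sum_(n < N.+1) p n = total p N (fun=> 1)) ?mulrA ?subrr//.
by apply: eq_bigr => n _; rewrite mulr1.
Qed.

(** One Euler step of the heat flow: for a small step, each new value is a convex
    combination of old values, so the box is preserved. *)
Lemma generator_box {R : realType} (a b f : nat -> R) N (l u t : R) :
  (forall n, 0 <= a n) -> (forall n, 0 <= b n) -> b 0%N = 0 -> a N = 0 ->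
  (forall n, l <= f n <= u) -> 0 <= t ->
  (forall n, (n <= N)%N -> t * (a n + b n) <= 1) ->
  forall n, (n <= N)%N -> l <= f n + t * generator a b f n <= u.
Proof.
move=> a0 b_ge0 b0 aN fb t0 ht n nN.
have tn := ht n nN.
suff [y yb ->] : exists2 y, l <= y <= u &
    f n + t * generator a b f n
    = (1 - t * (a n + b n)) * f n + t * a n * f n.+1 + t * b n * y.
  have ta : 0 <= t * a n by rewrite mulr_ge0.
  have tb : 0 <= t * b n by rewrite mulr_ge0.
  have tab : 0 <= 1 - t * (a n + b n) by rewrite subr_ge0.
  have /andP[l0 u0] := fb n; have /andP[l1 u1] := fb n.+1; move/andP: yb => [l2 u2].
  have := ler_wpM2l ta l1; have := ler_wpM2l ta u1.
  have := ler_wpM2l tb l2; have := ler_wpM2l tb u2.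
  have := ler_wpM2l tab l0; have := ler_wpM2l tab u0.
  by move=> *; apply/andP; split; lra.
case: n {nN tn} => [|n].
  by exists (f 0%N) => //; rewrite /generator /nabla_plus b0; ring.
by exists (f n) => //; rewrite /generator /nabla_plus /nabla_minus; ring.
Qed.

Lemma ler_sum_term {R : realType} (F : nat -> R) N n :
  (forall k, 0 <= F k) -> (n <= N)%N -> F n <= \sum_(k < N.+1) F k.
Proof.
move=> F0 nN; rewrite (bigD1 (Ordinal (nN : (n < N.+1)%N)))//= lerDl.
exact: sumr_ge0.
Qed.

Section FiniteMLSI.
Context {R : realType} (a b p : nat -> R) (N : nat) (c : R).
Hypotheses (a_ge0 : forall n, 0 <= a n) (b_ge0 : forall n, 0 <= b n).
Hypotheses (b0 : b 0%N = 0) (aN : a N = 0).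
Hypothesis p_ge0 : forall n, 0 <= p n.
Hypothesis p_gt0 : forall n, (n <= N)%N -> 0 < p n.
Hypothesis a_gt0 : forall n, (n < N)%N -> 0 < a n.
Hypothesis rates : forall n, (n < N)%N -> [/\ a n.+1 <= a n, b n <= b n.+1,
    a n * p n = b n.+1 * p n.+1 & c <= a n - a n.+1 + b n.+1 - b n].

Let db n : (n < N)%N -> a n * p n = b n.+1 * p n.+1.
Proof. by move=> /rates[]. Qed.

Lemma energy_ge0 f : (forall n, 0 < f n) -> 0 <= energy a p N f.
Proof.
move=> f0; apply: sumr_ge0 => n _.
by rewrite -mulrA; apply: mulr_ge0; [exact: mulr_ge0|exact: subM_ln_ge0].
Qed.

Lemma sum_generator (u w : nat -> R) : \sum_(n < N.+1) p n * (u n * generator a b w n) =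
  - \sum_(n < N) a n * p n * nabla_plus u n * nabla_plus w n.
Proof. by rewrite summation_by_parts// aN !mul0r add0r. Qed.

Lemma total_generator (f : nat -> R) : total p N (generator a b f) = 0.
Proof.
rewrite /total; under eq_bigr do rewrite -[generator _ _ _ _]mul1r.
rewrite (sum_generator (fun=> 1)) big1 ?oppr0// => n _.
by rewrite /nabla_plus subrr mulr0 mul0r.
Qed.

(** Along [L f] the total mass is constant, the entropy decreases at rate
    [energy], and the energy at the rate given by the dissipation. *)
Lemma is_derive_along_generator c' f : (forall n, 0 < f n) ->
  is_derive (0 : R) 1
    (fun t : R => energy a p N (fun n => f n + t * generator a b f n)
       - c' * finite_entropy p N (fun n => f n + t * generator a b f n))
    (c' * energy a p N f - \sum_(n < N.+1) p n * entropy_dissipation a b f n).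
Proof.
move=> f0; set v := generator a b f.
have tt t : total p N (fun n => f n + t * v n) = total p N f.
  rewrite /total; under eq_bigr do rewrite mulrDr mulrCA.
  by rewrite big_split/= -mulr_sumr -/(total p N v) total_generator mulr0 addr0.
set K := total p N f * ln (total p N f / total p N (fun=> 1)).
have -> : (fun t : R => energy a p N (fun n => f n + t * v n)
       - c' * finite_entropy p N (fun n => f n + t * v n)) =
   (fun t : R => energy a p N (fun n => f n + t * v n)
       - c' * (sum_flnf p N (fun n => f n + t * v n) - cst K t)).
  by apply/funext => t; rewrite /finite_entropy tt.
have hK : is_derive (0 : R) 1 (cst K) (0 : R) by exact: is_derive_cst.
have H := is_deriveB_fun _ _ _ _ _ (is_derive_energy a p N f v f0)
  (is_deriveMl_fun c' _ _ _ (is_deriveB_fun _ _ _ _ _ (is_derive_sum_flnf p N f v f0)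
     hK)).
apply: (is_derive_eq H); rewrite total_generator add0r subr0.
under [X in _ - _ * X = _]eq_bigr do rewrite (mulrC (v _)).
rewrite (sum_generator (fun k => ln (f k))).
under [X in X - _ = _]eq_bigr do rewrite mulrDr !mulrA (mulrAC _ (nabla_plus f _)).
rewrite big_split/=.
have h1 := sum_generator v (fun k => ln (f k)).
have h2 := sum_generator (fun k => v k / f k) f.
have -> : energy a p N f =
  \sum_(n < N) a n * p n * nabla_plus (fun k => ln (f k)) n * nabla_plus f n.
  by apply: eq_bigr => n _; rewrite mulrAC.
have -> : \sum_(n < N.+1) p n * entropy_dissipation a b f n =
  \sum_(n < N.+1) p n * (v n * generator a b (fun k => ln (f k)) n) +
  \sum_(n < N.+1) p n * (v n / f n * generator a b f n).
  rewrite -big_split; apply: eq_bigr => n _ /=.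
  by rewrite /entropy_dissipation -/v expr2 mulrDr (mulrAC _ (v n)).
rewrite h1 h2; lra.
Qed.

(** Minimality replaces the semigroup. At a minimizer [f0] of
    [energy - c' * entropy] on a box containing [f], the derivative in the
    direction [L f0], which points into the box, cannot be negative; but it is at
    most [(c' - c) * energy f0]. So [f0] has zero energy and is constant, and the
    minimum is 0. *)
Lemma finite_mlsi_lt c' f : 0 <= c' -> c' < c -> (forall n, 0 < f n) ->
  c' * finite_entropy p N f <= energy a p N f.
Proof.
move=> c'0 c'c f_gt0.
(* Bounds for [f] on the states up to [N], at the cost of two sums. *)
pose u := \sum_(k < N.+1) f k; pose l := (\sum_(k < N.+1) (f k)^-1)^-1.
have fu n : (n <= N)%N -> f n <= u by apply: ler_sum_term => k; exact: ltW.
have fV n : (n <= N)%N -> (f n)^-1 <= l^-1.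
  rewrite invrK; apply: (@ler_sum_term _ (fun k => (f k)^-1)) => k.
  by rewrite invr_ge0 ltW.
have l0 : 0 < l.
  by rewrite -invr_gt0 (lt_le_trans _ (fV 0%N _))// invr_gt0.
have fl n : (n <= N)%N -> l <= f n by move=> /fV; rewrite lef_pV2 ?posrE.
have [f0 [f0b f0min]] := ex_box_min a p N p_gt0 c' l u l0
  (le_trans (fl 0%N isT) (fu 0%N isT)).
have f0_gt0 n : 0 < f0 n by have /andP[/(lt_le_trans l0)] := f0b n.
have E0 : energy a p N f0 = 0.
  apply/eqP; rewrite eq_le energy_ge0// andbT leNgt; apply/negP => Epos.
  have [|e e0 he] := decreasing_near_right _ _ (is_derive_along_generator c' f0 f0_gt0).
    have := bochner_partial_sum a b p f0 c f0_gt0 b0 N p_ge0 a_ge0 b_ge0 rates.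
    rewrite /boundary aN !mul0r addr0 -/(energy a p N f0).
    have : 0 < (c - c') * energy a p N f0 by rewrite mulr_gt0// subr_gt0.
    lra.
  (* [1 / (1 + K)] is a step short enough at every state for [generator_box]. *)
  pose K := \sum_(k < N.+1) (a k + b k).
  have K0 : 0 <= K by apply: sumr_ge0 => k _; rewrite addr_ge0.
  pose t := Num.min (e / 2) (1 + K)^-1.
  have t0 : 0 < t by rewrite lt_min divr_gt0//= invr_gt0; lra.
  have te : t < e by rewrite gt_min; apply/orP; left; lra.
  have := he t t0 te; apply/negP; rewrite -leNgt.
  under [X in energy a p N X]eq_fun do rewrite mul0r addr0.
  under [X in finite_entropy p N X]eq_fun do rewrite mul0r addr0.
  apply: f0min; apply: generator_box => //; first exact: ltW.
  move=> n nN; have : a n + b n <= K.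
    by apply: (@ler_sum_term _ (fun k => a k + b k)) => // k; rewrite addr_ge0.
  move=> abK; rewrite (le_trans (ler_wpM2l (ltW t0) abK))//.
  have : t <= (1 + K)^-1 by rewrite ge_min lexx orbT.
  move=> /(ler_wpM2r K0)/le_trans; apply.
  by rewrite ler_pdivrMl; lra.
have f0cst n : (n <= N)%N -> f0 n = f0 0%N.
  elim: n => // n IH nN; rewrite -IH; last exact: ltnW.
  apply/esym/subM_ln_eq0 => //.
  move/eqP: E0; rewrite psumr_eq0 => [|i _]; last first.
    by rewrite -mulrA; apply: mulr_ge0; [exact: mulr_ge0|exact: subM_ln_ge0].
  move=> /allP/(_ (Ordinal nN)); rewrite mem_index_enum => /(_ isT)/eqP/=.
  rewrite -mulrA => /eqP; rewrite mulf_eq0 => /orP[|/eqP//].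
  by rewrite mulf_eq0 !gt_eqF ?a_gt0 ?p_gt0// ltnW.
have := f0min f (fun n nN => introT andP (conj (fl n nN) (fu n nN))); rewrite E0.
rewrite (eq_finite_entropy p N f0 (fun=> f0 0%N) f0cst).
by rewrite finite_entropy_cst ?gt_eqF ?total_gt0// mulr0 subr0 subr_ge0.
Qed.

(** The strict inequality [c' < c] made the minimizer constant; [c] itself is
    reached as a limit. *)
Lemma finite_mlsi f : 0 < c -> (forall n, 0 < f n) ->
  c * finite_entropy p N f <= energy a p N f.
Proof.
move=> c0 f0; rewrite leNgt; apply/negP => h.
have E0 := energy_ge0 f f0.
have ent0 : 0 < finite_entropy p N f.
  by rewrite -(pmulr_rgt0 _ c0) (le_lt_trans E0).
set E := energy _ _ _ _ in h E0 *; set H := finite_entropy _ _ _ in h ent0 *.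
have Ec : E / H < c by rewrite ltr_pdivrMr.
have EH0 : 0 <= E / H by rewrite divr_ge0// ltW.
pose c' := (c + E / H) / 2.
have c'0 : 0 <= c' by rewrite /c'; lra.
have c'c : c' < c by rewrite /c'; lra.
have : E / H < c' by rewrite /c'; lra.
by rewrite ltr_pdivrMr// ltNge finite_mlsi_lt.
Qed.

End FiniteMLSI.

(** * The entropy inequality on the infinite chain *)

(** If [a n = 0], no path leaves the states below [n.+1]. *)
Lemma irreducible_birth_gt0 {R : realType} (a b : nat -> R) :
  (forall n, 0 <= a n) -> irreducible_chain (generator a b) ->
  forall n, 0 < a n.
Proof.
move=> a_ge0 irr n; rewrite lt_neqAle a_ge0 andbT; apply/eqP => an.
have stay s : forall i, (i <= n)%N ->
    path (fun x y => (x != y) && (0 < jump_rate (generator a b) x y)) i s ->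
    (last i s <= n)%N.
  elim: s => //= y s IH i iN /andP[/andP[iy rate_gt0]]; apply: IH.
  rewrite leqNgt; apply/negP => ny; move: rate_gt0.
  rewrite /jump_rate /generator /nabla_plus (negbTE iy) subr0.
  have -> : nabla_minus (fun k => (k == y)%:R : R) i = 0.
    rewrite /nabla_minus; case: (i) iN iy => // i' iN' iy.
    by rewrite (negbTE iy) ltn_eqF ?subrr// (leq_trans iN')// ltnW.
  rewrite mulr0 addr0; have [iy1|] := eqVneq i.+1 y; last by rewrite mulr0 ltxx.
  have -> : i = n by apply/eqP; rewrite eqn_leq iN/= -ltnS iy1.
  by rewrite -an mul0r ltxx.
have [s [ps ls]] := irr n n.+1.
by have := stay s n (leqnn n) ps; rewrite ls ltnn.
Qed.

(** If [b n.+1 = 0], no path leaves the states above [n]. *)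
Lemma irreducible_death_gt0 {R : realType} (a b : nat -> R) :
  (forall n, 0 <= b n) -> irreducible_chain (generator a b) ->
  forall n, 0 < b n.+1.
Proof.
move=> b_ge0 irr n; rewrite lt_neqAle b_ge0 andbT; apply/eqP => bn.
have stay s : forall i, (n < i)%N ->
    path (fun x y => (x != y) && (0 < jump_rate (generator a b) x y)) i s ->
    (n < last i s)%N.
  elim: s => //= y s IH i iN /andP[/andP[iy rate_gt0]]; apply: IH.
  rewrite ltnNge; apply/negP => yn; move: rate_gt0.
  rewrite /jump_rate /generator /nabla_plus (negbTE iy).
  rewrite gtn_eqF ?subrr ?mulr0 ?add0r; last first.
    by rewrite (leq_ltn_trans yn)// (ltn_trans iN).
  rewrite /nabla_minus; case: (i) iN iy => // i' iN' iy.
  rewrite (negbTE iy) subr0; have [iy1|] := eqVneq i' y; last by rewrite mulr0 ltxx.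
  have -> : i' = n by apply/eqP; rewrite eqn_leq {1}iy1 yn -ltnS iN'.
  by rewrite -bn mul0r ltxx.
have [s [ps ls]] := irr n.+1 0%N.
by have := stay s n.+1 (leqnn _) ps; rewrite ls.
Qed.

Lemma relative_entropy_term_ge0 {R : realType} (x m : R) : 0 < x -> 0 < m ->
  0 <= x * (ln x - ln m) - x + m.
Proof.
move=> x0 m0; have := ln_ge_1subV (x / m) (divr_gt0 x0 m0).
rewrite ln_div ?posrE// invf_div => /(ler_wpM2l (ltW x0)).
by rewrite mulrBr mulr1 mulrCA divff ?mulr1 ?lt0r_neq0//; lra.
Qed.

(** The tangent of [ln] at [2 * x]: any slope below 1 in [m] would do, as
    [averages_bounded] only has to absorb this term into [m]. *)
Lemma mulr_ln_div_le {R : realType} (x m : R) : 0 < x -> 0 < m ->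
  x * (ln m - ln x) <= x * (ln 2 - 1) + m / 2.
Proof.
move=> x0 m0; have x20 : 0 < 2 * x by rewrite mulr_gt0.
have := ln_le_sub1 _ (divr_gt0 m0 x20).
rewrite ln_div ?posrE// lnM ?posrE// => /(ler_wpM2l (ltW x0)).
have -> : x * (m / (2 * x) - 1) = m / 2 - x by field; rewrite lt0r_neq0.
lra.
Qed.

Section MLSI.
Context {R : realType} (a b : nat -> R) (pi : probability nat R) (c : R).
Hypotheses (a_gt0 : forall n, 0 < a n) (b_gt0 : forall n, 0 < b n.+1).
Hypothesis b0 : b 0%N = 0.
Hypothesis detailed_balance :
  forall n, a n * mass pi n = b n.+1 * mass pi n.+1.
Hypothesis a_noninc : forall n, a n.+1 <= a n.
Hypothesis b_nondec : forall n, b n <= b n.+1.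
Hypothesis c_gt0 : 0 < c.
Hypothesis curvature : forall n, c <= a n - a n.+1 + b n.+1 - b n.

Let p := mass pi.
Let p_ge0 n : 0 <= p n := mass_ge0 pi n.
Let Z N := total p N (fun=> 1).

Lemma mean1 : mean pi (fun=> 1) = 1%E.
Proof.
rewrite /mean (integral_cst pi measurableT 1%E) mul1e.
exact: probability_setT.
Qed.

Lemma total_mass_le1 N : Z N <= 1.
Proof. by rewrite -lee_fin -mean1; apply: partial_sum_le_mean. Qed.

Lemma total_mass_cvg : Z N @[N --> \oo] --> (1 : R).
Proof.
have := ge0_partial_sum_cvg_mean pi (fun=> 1) (fun=> ler01).
by rewrite mean1 => /(_ (ltry _)); rewrite -(cvg_shiftS (fun N => \sum_(n < N) _)).
Qed.

Lemma mass_gt0 n : 0 < p n.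
Proof.
elim: n => [|n IH]; last first.
  by rewrite -(pmulr_rgt0 _ (b_gt0 n)) -detailed_balance mulr_gt0.
rewrite lt_neqAle p_ge0 andbT; apply/eqP => p0.
have pE n : p n = 0.
  elim: n => // n IH; apply/eqP; have := detailed_balance n.
  rewrite -/p IH mulr0 => /esym/eqP.
  by rewrite mulf_eq0 gt_eqF.
have : Z N @[N --> \oo] --> (0 : R).
  rewrite (_ : Z = cst 0); first exact: cvg_cst.
  by apply/funext => N; rewrite /Z /total big1// => n _; rewrite pE mul0r.
move=> /(cvg_unique (@Rhausdorff _) total_mass_cvg)/eqP.
by rewrite oner_eq0.
Qed.

Variable f : nat -> R.
Hypothesis f_gt0 : forall n, 0 < f n.

Let D := mean pi (fun n => a n * nabla_plus f n * nabla_plus (fun k => ln (f k)) n).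

Let integrand_ge0 n : 0 <= a n * nabla_plus f n * nabla_plus (fun k => ln (f k)) n.
Proof. by rewrite -mulrA mulr_ge0 ?subM_ln_ge0// ltW. Qed.

(** Setting the birth rate to 0 from [N] on keeps all the hypotheses on the
    states up to [N]: monotonicity and the curvature bound at [N.-1] can only
    improve. *)
Lemma truncated_mlsi N : (D < +oo)%E -> c * finite_entropy p N f <= fine D.
Proof.
move=> Dy; pose a' n := if (n < N)%N then a n else 0.
apply: (@le_trans _ _ (energy a' p N f)).
  apply: (finite_mlsi a' b p N c) => //.
  - by move=> n; rewrite /a'; case: ifP => // _; exact: ltW.
  - by case=> [|n]; [rewrite b0|exact: ltW].
  - by rewrite /a' ltnn.
  - by move=> n _; exact: mass_gt0.
  - by move=> n nN; rewrite /a' nN.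
  - move=> n nN; rewrite /a' nN; split => //; case: ifP => // _.
      exact: ltW.
    by rewrite (le_trans (curvature n))// !lerD2r lerB// ltW.
rewrite -lee_fin fineK ?ge0_fin_numE ?mean_ge0//.
apply: le_trans (partial_sum_le_mean pi _ N integrand_ge0).
rewrite lee_fin le_eqVlt; apply/orP; left; apply/eqP.
by apply: eq_bigr => n _; rewrite /a' ltn_ord -/p !mulrA (mulrC (a n)).
Qed.

(** Entropy relative to the average is a sum of nonnegative terms, so that it
    bounds each of them. *)
Lemma finite_entropyE N (m := total p N f / Z N) :
  finite_entropy p N f =
  \sum_(n < N.+1) p n * (f n * (ln (f n) - ln m) - f n + m).
Proof.
have Z0 : 0 < Z N by apply: total_gt0 => // n _; exact: mass_gt0.
have -> : finite_entropy p N f =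
    sum_flnf p N f - total p N f * ln m - total p N f + m * Z N.
  by rewrite divfK ?gt_eqF// addrNK.
rewrite /sum_flnf /Z /total mulr_suml mulr_sumr -!sumrB -big_split.
by apply: eq_bigr => n _ /=; ring.
Qed.

(** Finite energy forces integrability: the term of state 0 in [finite_entropyE]
    grows linearly with the average [m], while the entropy stays below
    [fine D / c]. *)
Lemma averages_bounded : (D < +oo)%E ->
  exists2 M, 0 <= M & forall N, total p N f / Z N <= M.
Proof.
move=> Dy; have D0 : 0 <= fine D by rewrite fine_ge0 ?mean_ge0.
exists (2 * (fine D / (c * p 0%N) + f 0%N * ln 2)).
  rewrite mulr_ge0// addr_ge0//; first by rewrite divr_ge0// ltW// mulr_gt0// mass_gt0.
  by rewrite mulr_ge0 ?ln_ge0 ?ler1n// ltW.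
move=> N; set m := _ / _.
have m0 : 0 < m by rewrite divr_gt0 ?total_gt0// => n _; exact: mass_gt0.
have H1 : p 0%N * (f 0%N * (ln (f 0%N) - ln m) - f 0%N + m) <= fine D / c.
  rewrite ler_pdivlMr// mulrC (le_trans _ (truncated_mlsi N Dy))//.
  rewrite ler_wpM2l ?(ltW c_gt0)// finite_entropyE -/m.
  apply: (@ler_sum_term _ (fun n => p n * (f n * (ln (f n) - ln m) - f n + m))) => // k.
  by rewrite mulr_ge0 ?relative_entropy_term_ge0.
clearbody m; have H2 := mulr_ln_div_le (f 0%N) m (f_gt0 _) m0.
have : p 0%N * (m / 2 - f 0%N * ln 2) <= fine D / c.
  by rewrite (le_trans _ H1)// ler_wpM2l//; lra.
rewrite mulrC -ler_pdivlMr ?mass_gt0// invfM -mulrA; lra.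
Qed.

(** Bounded averages make the partial sums of [f] and of [f * ln f] bounded, so
    both functions are integrable and the truncated entropies converge to the
    entropy of [f]. *)
Lemma mlsi : (c%:E * entropy pi f <= D)%E.
Proof.
have [Dy|] := ltP D +oo%E; last by rewrite leye_eq => /eqP ->; rewrite leey.
have [M M0 HM] := averages_bounded Dy.
pose T N := total p N f; pose H N := sum_flnf p N f.
have Z0 N : 0 < Z N by apply: total_gt0 => // n _; exact: mass_gt0.
have T0 N : 0 < T N by apply: total_gt0 => // n _; exact: mass_gt0.
have TM N : T N <= M.
  have := HM N; rewrite ler_pdivrMr// => /le_trans; apply.
  by rewrite ler_piMr// total_mass_le1.
have entN N : H N - T N * ln (T N / Z N) <= fine D / c.
  by rewrite ler_pdivlMr// mulrC truncated_mlsi.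
have HB N : H N <= fine D / c + M * M.
  have : T N * ln (T N / Z N) <= M * M.
    apply: (@le_trans _ _ (T N * M)); last by rewrite ler_wpM2r.
    rewrite ler_wpM2l ?(ltW (T0 _))//.
    have TZ0 : 0 < T N / Z N by rewrite divr_gt0.
    have := ln_le_sub1 _ TZ0; have := HM N; rewrite -/(T N); lra.
  have := entN N; lra.
have mean_lty (F : nat -> R) K : (forall n, 0 <= F n) ->
    (forall N, \sum_(n < N.+1) p n * F n <= K) -> (mean pi F < +oo)%E.
  move=> F0 FK; apply: (@le_lt_trans _ _ K%:E); last exact: ltry.
  apply: mean_le_ub => // N; rewrite (le_trans _ (FK N))// big_ord_recr/= lerDl.
  by rewrite mulr_ge0.
have f_lty : (mean pi f < +oo)%E.
  by apply: (mean_lty f M) => // n; exact: ltW.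
have flnf_int : pi.-integrable setT (fun n => (f n * ln (f n))%R%:E).
  apply: integrable_mean; apply: (mean_lty _ (fine D / c + M * M + 2)) => // N.
  apply: (@le_trans _ _ (H N + 2 * Z N)); last first.
    by rewrite lerD// ler_piMr// total_mass_le1.
  rewrite /H /sum_flnf /Z /total mulr_sumr -big_split; apply: ler_sum => n _ /=.
  rewrite mulr1 (mulrC 2) -mulrDr ler_wpM2l//.
  have := relative_entropy_term_ge0 (f n) 1 (f_gt0 n) ltr01; rewrite ln1 subr0.
  have := f_gt0 n; rewrite ler_norml; move=> *; apply/andP; split; lra.
rewrite /entropy flnf_int.
rewrite -[mean pi (fun n => f n * ln (f n))%R]fineK ?integrable_fin_num//.
rewrite -EFinB -[leRHS]fineK ?ge0_fin_numE ?mean_ge0// -EFinM lee_fin.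
set h := fine (mean pi (fun n => _ * _)%R); set m := fine (mean pi f).
rewrite mulrC -ler_pdivlMr//.
have fi : pi.-integrable setT (EFin \o f).
  by apply: integrable_mean; under eq_fun do rewrite gtr0_norm//.
have cH : H N @[N --> \oo] --> h.
  have := partial_sum_cvg_mean pi (fun n => f n * ln (f n)) flnf_int.
  by rewrite -(cvg_shiftS (fun N => \sum_(n < N) _)).
have cT : T N @[N --> \oo] --> m.
  have := partial_sum_cvg_mean pi f fi.
  by rewrite -(cvg_shiftS (fun N => \sum_(n < N) _)).
have m0 : 0 < m.
  rewrite (lt_le_trans (T0 0%N))// -lee_fin fineK ?ge0_fin_numE ?mean_ge0//.
    by apply: partial_sum_le_mean => n; exact: ltW.
  by move=> n; exact: ltW.
have cTZ : (T N / Z N) @[N --> \oo] --> m.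
  rewrite -[X in _ --> X]divr1; apply: cvgM cT _; apply: cvgV total_mass_cvg.
  exact: oner_neq0.
have cE : (H N - T N * ln (T N / Z N)) @[N --> \oo] --> h - m * ln m.
  apply: cvgB cH _; apply: cvgM cT _.
  by apply: (cvg_comp _ _ cTZ); exact: continuous_ln.
rewrite -(cvg_lim (@Rhausdorff _) cE); apply: limr_le; first exact: cvgP cE.
exact: nearW.
Qed.

End MLSI.

Theorem theorem3p1 (R : realType) (a b : nat -> R) (pi : probability nat R)
    (c : R)
    (a_ge0 : forall n, 0 <= a n)
    (b_ge0 : forall n, 0 <= b n)
    (b0 : b 0%N = 0)
    (detailed_balance : forall n : nat,
       ((a n)%:E * pi [set n] = (b n.+1)%:E * pi [set n.+1])%E)
    (irr : irreducible_chain (generator a b))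
    (a_noninc : forall n, a n.+1 <= a n)
    (b_nondec : forall n, b n <= b n.+1)
    (c_gt0 : 0 < c)
    (curvature : forall n, c <= a n - a n.+1 + b n.+1 - b n) :
  (forall f : nat -> R, (forall n, 0 < f n) ->
     (mean pi (fun n => abs_generator a b f n
                        * abs_generator a b (fun k => ln (f k)) n)%R
        < +oo)%E ->
     (mean pi (fun n => abs_generator a b f n ^+ 2 / f n)%R < +oo)%E ->
     (c%:E * dirichlet a pi f (fun k => ln (f k)) <=
        mean pi (fun n => generator a b f n
                          * generator a b (fun k => ln (f k)) n)%R
        + mean pi (fun n => generator a b f n ^+ 2 / f n)%R)%E)
  /\
  (forall f : nat -> R, (forall n, 0 < f n) ->
     (c%:E * entropy pi f <= dirichlet a pi f (fun k => ln (f k)))%E).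
Proof.
have db n : a n * mass pi n = b n.+1 * mass pi n.+1.
  by have := detailed_balance n; rewrite !massE -!EFinM => -[].
split=> f f_gt0; first exact: bakry_emery.
apply: (mlsi a b) => // n; first exact: (@irreducible_birth_gt0 _ a b).
exact: (@irreducible_death_gt0 _ a b).
Qed.
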